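(* For $n\in\mathbb Z_+=\{0,1,2,\dots\}$ let $I_{-n}=\{te^{\frac{i\pi}{n+2}}:0\le t\le\frac1{n+1}\}$ and $I_n=\{te^{i(\pi-\frac{\pi}{n+2})}:0\le t\le\frac1{n+1}\}$ in $\mathbb C$ (the two definitions of $I_0$ agree), and let $S=\bigcup_{n\in\mathbb Z}I_n$ with the Euclidean metric. Define $g:S\to S$ by, for every $n\in\mathbb Z_+$, $$g\big(te^{\frac{i\pi}{n+3}}\big)=\tfrac{n+2}{n+1}\,t\,e^{\frac{i\pi}{n+2}}\ \ \text{for } t\in[0,\tfrac1{n+2}],\qquad g\big(te^{i(\pi-\frac{\pi}{n+2})}\big)=\tfrac{n+1}{n+2}\,t\,e^{i(\pi-\frac{\pi}{n+3})}\ \ \text{for } t\in[0,\tfrac1{n+1}].$$ Then $S$ is a dendrite, $g$ is a homeomorphism of $S$ with $\mathrm{Fix}(g)=\{0\}$ and $g(I_n)=I_{n+1}$ for all $n\in\mathbb Z$, every point of $S$ is asymptotic to $0$ under $g$, and $g$ has zero topological entropy; whereas the induced map $\mathcal C(g):\mathcal C(S)\to\mathcal C(S)$ is $\omega$-chaotic and has infinite topological entropy.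
   Context: A dendrite is a locally connected continuum (compact connected metric space) containing no simple closed curve. $\mathcal C(S)$ is the set of all subcontinua of $S$ (nonempty compact connected subsets, singletons included) with the Hausdorff metric, and $\mathcal C(g)(A)=g(A)$. For a continuous self-map $F$ of a compact metric space $(Y,\rho)$: $\mathrm{Fix}(F)$ and $\mathrm P(F)$ are the sets of fixed and periodic points; $\omega_F(y)=\bigcap_{n\ge1}\overline{\{F^k(y):k\ge n\}}$; $x,y$ are asymptotic if $\limsup_{k\to\infty}\rho(F^k(x),F^k(y))=0$. A set $E\subset Y$ with at least two points is $\omega$-scrambled for $F$ if for all $x\ne y$ in $E$: (i) $\omega_F(x)\setminus\omega_F(y)$ is uncountable, (ii) $\omega_F(x)\cap\omega_F(y)\ne\emptyset$, (iii) $\omega_F(x)\setminus \mathrm P(F)\neq\emptyset$. $F$ is $\omega$-chaotic if it has an uncountable $\omega$-scrambled set. Topological entropy is $h(F)=\lim_{\varepsilon\to0}\limsup_{m\to\infty}\frac1m\log \mathrm{sep}(m,F,\varepsilon)$, where $\mathrm{sep}(m,F,\varepsilon)$ is the maximal cardinality of a set $E\subset Y$ such that any two distinct $x,y\in E$ satisfy $\rho(F^j(x),F^j(y))>\varepsilon$ for some $0\le j<m$. *)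

(* Defs.v *)
From HB Require Import structures.
From mathcomp Require Import all_boot all_order all_algebra.
From mathcomp Require Import finmap.
From mathcomp Require Import all_classical all_reals all_analysis.
From mathcomp Require Import complex lra.

Set Implicit Arguments.
Unset Strict Implicit.
Unset Printing Implicit Defensive.

Import Order.TTheory GRing.Theory Num.Theory.
Import numFieldNormedType.Exports.

Local Open Scope classical_set_scope.
Local Open Scope ring_scope.

(* [Rcomplex R] is R[i] seen as a real normed vector space: its norm is the
   Euclidean norm with values in R, so the distance below is the Euclidean
   distance of the plane. *)
Section complex_plane.
Variable R : realType.
Implicit Types x y z : Rcomplex R.

Let edist x y : R := `|x - y|.

Let edistxx x : edist x x = 0.
Proof. by rewrite /edist subrr normr0. Qed.

Let edist_positivity x y : edist x y = 0 -> x = y.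
Proof. by move/normr0_eq0/eqP; rewrite subr_eq0 => /eqP. Qed.

Let edist_sym x y : edist x y = edist y x.
Proof. exact: distrC. Qed.

Let edist_triangle y x z : edist x z <= edist x y + edist y z.
Proof. exact: ler_distD. Qed.

HB.instance Definition _ := isMetric.Build R (Rcomplex R)
  edistxx edist_positivity edist_sym edist_triangle.

End complex_plane.

(* The restricted metric on a subset; the pseudometric structure it extends is
   the library's one on [set_type A], so the topology is the subspace one. *)
Section subset_metric.
Variables (R : realType) (T : metricType R) (A : set T).

Let sdist (x y : A) : R := mdist (set_val x) (set_val y).

Let sdist_ge0 x y : 0 <= sdist x y.
Proof. exact: mdist_ge0. Qed.

Let sdist_positivity x y : sdist x y = 0 -> x = y.
Proof. by move=> /mdist_positivity /val_inj. Qed.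

Let ballEsdist (x : A) d : ball x d = [set y | sdist x y < d].
Proof. by rewrite -[LHS]initial_ballE ballEmdist. Qed.

HB.instance Definition _ := PseudoMetric_isMetric.Build R (set_type A)
  sdist_ge0 sdist_positivity ballEsdist.

End subset_metric.

Definition continuum {T : topologicalType} (A : set T) : Prop :=
  [/\ A !=set0, compact A & connected A].

Definition homeomorphism {X Y : topologicalType} (f : X -> Y) : Prop :=
  continuous f /\
  exists g : Y -> X, [/\ continuous g, cancel f g & cancel g f].

Definition locally_connected (T : topologicalType) : Prop :=
  forall (x : T) (U : set T), nbhs x U ->
    exists V : set T, [/\ open V, V x, connected V & V `<=` U].

Definition unit_circle (R : realType) : set (Rcomplex R) :=
  [set z | `|z| = 1].
Arguments unit_circle R : clear implicits.

Definition simple_closed_curve {R : realType} {T : metricType R} (A : set T) :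
  Prop := exists f : set_type (unit_circle R) -> set_type A, homeomorphism f.

Definition dendrite {R : realType} (T : metricType R) : Prop :=
  [/\ continuum [set: T], locally_connected T &
      ~ exists A : set T, simple_closed_curve A].

Record subcontinuum (T : topologicalType) := Subcontinuum {
  subcontinuum_set :> set T;
  subcontinuumP : continuum subcontinuum_set }.

Lemma subcontinuum_inj {T : topologicalType} (A B : subcontinuum T) :
  A = B :> set T -> A = B.
Proof.
by case: A B => [A cA] [B cB] /= AB; subst B; congr Subcontinuum.
Qed.

HB.instance Definition _ (T : topologicalType) :=
  gen_eqMixin (subcontinuum T).
HB.instance Definition _ (T : topologicalType) :=
  gen_choiceMixin (subcontinuum T).

Section hausdorff_metric.
Variables (R : realType) (T : metricType R).
Implicit Types A B C : subcontinuum T.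

Definition hausdorff_radii (A B : set T) : set R :=
  [set e | [/\ 0 < e,
     forall a, A a -> exists2 b, B b & mdist a b < e &
     forall b, B b -> exists2 a, A a & mdist b a < e]].

Definition hausdorff_dist (A B : set T) : R := inf (hausdorff_radii A B).

Let radii_lb A B : lbound (hausdorff_radii A B) 0.
Proof. by move=> e [/ltW]. Qed.

Lemma compact_mdist_bounded (A : set T) (x : T) : compact A ->
  exists2 M : R, 0 < M & forall a, A a -> mdist x a < M.
Proof.
move=> cA.
have cd : continuous (mdist x : T -> R^o).
  move=> y; apply/cvgrPdist_lt => e e0; near=> z.
  have yz : mdist y z < e.
    near: z; apply/metricType_numDomainType.nbhs_mdistP.
    by exists e.
  have := metric_triangle x y z; have := metric_triangle x z y.
  rewrite (metric_sym z y) ltr_norml => xyz xzy.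
  by apply/andP; split; lra.
have : compact ((mdist x : T -> R^o) @` A).
  by apply: continuous_compact => //; exact: continuous_subspaceT.
move=> /compact_bounded [M [_ MP]].
exists (`|M| + 1 + 1); first by rewrite -addrA ltr_wpDl// addr_gt0.
move=> a Aa; rewrite (@le_lt_trans _ _ (`|M| + 1)) ?ltrDl//.
apply: le_trans (ler_norm _) _.
apply: (MP (`|M| + 1)); last by exists a.
by rewrite (le_lt_trans (ler_norm M))// ltrDl.
Unshelve. all: by end_near. Qed.

Let radii_neq0 A B : hausdorff_radii A B !=set0.
Proof.
have [[a Aa] cA _] := subcontinuumP A.
have [[b Bb] cB _] := subcontinuumP B.
have [M M0 MP] := compact_mdist_bounded b cA.
have [N N0 NP] := compact_mdist_bounded a cB.
exists (M + N); split; first exact: addr_gt0.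
  move=> x Ax; exists b => //.
  by rewrite metric_sym (lt_le_trans (MP _ Ax))// lerDl ltW.
move=> x Bx; exists a => //.
by rewrite metric_sym (lt_le_trans (NP _ Bx))// lerDr ltW.
Qed.

Let radii_inf A B : has_inf (hausdorff_radii A B).
Proof. by split; [exact: radii_neq0|exists 0; exact: radii_lb]. Qed.

Let hdistxx A : hausdorff_dist A A = 0.
Proof.
apply/eqP; rewrite eq_le lb_le_inf ?andbT; last 2 first.
- exact: radii_neq0.
- exact: radii_lb.
apply/ler_addgt0Pl => e e0; rewrite addr0.
apply: ge_inf; first by exists 0; exact: radii_lb.
by split => // a Aa; exists a => //; rewrite mdistxx.
Qed.

Let hdist0_sub A B : hausdorff_dist A B = 0 -> (A : set T) `<=` B.
Proof.
move=> AB0 a Aa.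
have [_ /(compact_closed (@metric_hausdorff _ T)) clB _] := subcontinuumP B.
apply: clB => V /metricType_numDomainType.nbhs_mdistP[e /= e0 eV].
have [e' [_ AB _]] := inf_adherent e0 (radii_inf A B).
rewrite -/(hausdorff_dist A B) AB0 add0r => e'e.
have [b Bb abe] := AB _ Aa.
by exists b; split => //; apply: eV => /=; exact: lt_trans e'e.
Qed.

Let hdist_sym A B : hausdorff_dist A B = hausdorff_dist B A.
Proof. by congr inf; apply/seteqP; split => e [? ? ?]; split. Qed.

Let hdist_positivity A B : hausdorff_dist A B = 0 -> A = B.
Proof.
move=> AB; apply: subcontinuum_inj; apply/seteqP; split.
  exact: hdist0_sub.
by apply: hdist0_sub; rewrite hdist_sym.
Qed.

Let hdist_triangle B A C :
  hausdorff_dist A C <= hausdorff_dist A B + hausdorff_dist B C.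
Proof.
apply/ler_addgt0Pr => e e0; have e20 : 0 < e / 2 by rewrite divr_gt0.
have [r [r0 AB BA] rlt] := inf_adherent e20 (radii_inf A B).
have [s [s0 BC CB] slt] := inf_adherent e20 (radii_inf B C).
apply: (@le_trans _ _ (r + s)); last first.
  by rewrite [e in leRHS]splitr addrACA lerD// ltW.
apply: ge_inf; first by exists 0; exact: radii_lb.
split; first exact: addr_gt0.
  move=> a /AB[b Bb ab]; have [c Cc bc] := BC _ Bb; exists c => //.
  by rewrite (le_lt_trans (metric_triangle _ b _))// ltrD.
move=> c /CB[b Bb cb]; have [a Aa ba] := BA _ Bb; exists a => //.
by rewrite (le_lt_trans (metric_triangle _ b _))// addrC ltrD.
Qed.

HB.instance Definition _ := isMetric.Build R (subcontinuum T)
  hdistxx hdist_positivity hdist_sym hdist_triangle.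

End hausdorff_metric.

Lemma continuum_image {T : topologicalType} (f : T -> T) (A : set T) :
  continuous f -> continuum A -> continuum (f @` A).
Proof.
move=> cf [[a Aa] cA coA]; split; first by exists (f a); exists a.
- by apply: continuous_compact => //; exact: continuous_subspaceT.
- by apply: connected_continuous_connected => //; exact: continuous_subspaceT.
Qed.

Definition induced_map {T : topologicalType} (f : T -> T) (cf : continuous f)
    (A : subcontinuum T) : subcontinuum T :=
  Subcontinuum (continuum_image cf (subcontinuumP A)).

Section dynamics.
Variables (R : realType) (Y : metricType R) (F : Y -> Y).

Definition fixed_points : set Y := [set y | F y = y].

Definition periodic_points : set Y :=
  [set y | exists2 k, (0 < k)%N & iter k F y = y].

Definition omega_limit (y : Y) : set Y :=
  \bigcap_(n in [set n | (1 <= n)%N])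
    closure [set iter k F y | k in [set k | (n <= k)%N]].

Definition asymptotic (x y : Y) : Prop :=
  limn_esup (fun k => (mdist (iter k F x) (iter k F y))%:E) = 0%E.

Definition omega_scrambled (E : set Y) : Prop :=
  (exists x y, [/\ E x, E y & x <> y]) /\
  forall x y, E x -> E y -> x <> y ->
    [/\ ~ countable (omega_limit x `\` omega_limit y),
        omega_limit x `&` omega_limit y !=set0 &
        omega_limit x `\` periodic_points !=set0].

Definition omega_chaotic : Prop :=
  exists E : set Y, ~ countable E /\ omega_scrambled E.

Definition separated_set (m : nat) (e : R) (E : set Y) : Prop :=
  forall x y, E x -> E y -> x <> y ->
    exists2 j, (j < m)%N & e < mdist (iter j F x) (iter j F y).

(* maximal cardinality, equal to +oo when it is not bounded *)
Definition sep (m : nat) (e : R) : \bar R :=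
  ereal_sup [set counting E | E in [set E | separated_set m e E]].

Definition entropy_at (e : R) : \bar R :=
  limn_esup (fun m => ((m%:R^-1)%:E * lne (sep m e))%E).

Lemma sep_ge0 (m : nat) (e : R) : (0 <= sep m e)%E.
Proof.
apply: ereal_sup_ubound; exists set0; first by move=> x y [].
by rewrite /counting asboolT// fset_set0.
Qed.

Lemma sep_nonincreasing (m : nat) (e1 e2 : R) :
  e1 <= e2 -> (sep m e2 <= sep m e1)%E.
Proof.
move=> e12; apply: ereal_sup_le => _ [E sE <-]; exists E => // x y Ex Ey xy.
by have [j jm /(le_lt_trans e12)] := sE _ _ Ex Ey xy; exists j.
Qed.

Lemma entropy_at_nonincreasing (e1 e2 : R) :
  e1 <= e2 -> (entropy_at e2 <= entropy_at e1)%E.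
Proof.
move=> e12; apply: le_ereal_inf_tmp => _ [V nV <-].
apply: (@le_trans _ _ (ereal_sup
  ((fun m => ((m%:R^-1)%:E * lne (sep m e2))%E) @` V))).
  by apply: ereal_inf_lbound; exists V.
apply: ge_ereal_sup => _ [m Vm <-].
apply: (@le_trans _ _ ((m%:R^-1)%:E * lne (sep m e1))%E); last first.
  by apply: ereal_sup_ubound; exists m.
rewrite lee_wpmul2l ?lee_fin ?invr_ge0//.
by rewrite lee_lne ?sep_nonincreasing// in_itv/= sep_ge0 leey.
Qed.

Lemma is_cvg_entropy_at : cvg (entropy_at e @[e --> 0^'+]).
Proof.
apply: nonincreasing_at_right_is_cvge; near=> x => y z _ _.
exact: entropy_at_nonincreasing.
Unshelve. all: by end_near. Qed.

Definition entropy : \bar R := lim (entropy_at e @[e --> 0^'+]).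

End dynamics.

Section example_space.
Variable R : realType.

(* e^{i theta} *)
Definition cis (theta : R) : Rcomplex R := Complex (cos theta) (sin theta).

(* [plane_arc_neg n] is I_{-n}, [plane_arc_pos n] is I_n *)
Definition plane_arc_neg (n : nat) : set (Rcomplex R) :=
  [set t *: cis (pi / n.+2%:R) | t in `[0, n.+1%:R^-1]].

Definition plane_arc_pos (n : nat) : set (Rcomplex R) :=
  [set t *: cis (pi - pi / n.+2%:R) | t in `[0, n.+1%:R^-1]].

(* [Negz n] is the integer - (n + 1) *)
Definition plane_arc (z : int) : set (Rcomplex R) :=
  match z with Posz n => plane_arc_pos n | Negz n => plane_arc_neg n.+1 end.

Lemma plane_arc_opp (n : nat) : plane_arc (- n%:Z) = plane_arc_neg n.
Proof.
case: n => [|n]; last by rewrite -NegzE.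
by rewrite /= /plane_arc_pos /plane_arc_neg [X in X - _]splitr addrK.
Qed.

Definition star_set : set (Rcomplex R) := \bigcup_(n in [set: int]) plane_arc n.

Definition star : Type := set_type star_set.

HB.instance Definition _ := Metric.on star.

Lemma star_set0 : star_set 0.
Proof.
by exists 0 => //; exists 0; rewrite ?scale0r//= in_itv/= lexx invr_ge0 ler0n.
Qed.

Definition star0 : star := exist _ 0 (mem_set star_set0).

Definition star_arc (n : int) : set star := [set x | plane_arc n (\val x)].

Definition star_shift (g : star -> star) : Prop := forall n : nat,
  (forall (t : R) (x : star), 0 <= t <= n.+2%:R^-1 ->
     \val x = t *: cis (pi / n.+3%:R) ->
     \val (g x) = (n.+2%:R / n.+1%:R * t) *: cis (pi / n.+2%:R)) /\
  (forall (t : R) (x : star), 0 <= t <= n.+1%:R^-1 ->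
     \val x = t *: cis (pi - pi / n.+2%:R) ->
     \val (g x) = (n.+1%:R / n.+2%:R * t) *: cis (pi - pi / n.+3%:R)).

End example_space.
Arguments star_arc R n : clear implicits.

(* Main.v *)
Require Import Defs.
From mathcomp Require Import all_boot all_order all_algebra.
From mathcomp Require Import all_classical all_reals all_analysis.
From mathcomp Require Import complex lra ring zify.
Import Order.TTheory GRing.Theory Num.Theory.
Import numFieldNormedType.Exports.
Local Open Scope classical_set_scope.
Local Open Scope ring_scope.

Set Implicit Arguments.
Unset Strict Implicit.
Unset Printing Implicit Defensive.

(** Every point of the star is [pt z s], at relative height [s] in [0, 1] on the
    arc [I_z], and [height z] is a Lipschitz function reading this coordinate
    back; [g] is [pt z s |-> pt (z + 1) s].  A simple closed curve would cross
    some positive level of some [height z] on both of its arcs, but that level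
    is a single point.  In a window of length [m] only about [m] arcs come away
    from 0, so [sep] grows linearly in [m].

    A function [a : int -> [0, 1]] gives the subcontinuum [comb a] made of the
    points [pt z s] with [s <= a z], and [C(g)] acts on these combs as the full
    shift.  Finite grids of values give arbitrarily large entropy.  For
    omega-chaos, the comb of parameter [r] shows pairs of pulses [r, w_l] at
    exponentially sparse times, the [w_l] being dense in an interval below all
    the [r]'s: its omega-limit set contains the zero comb and uncountably many
    combs with at most two teeth, one of which has height [r] and so identifies [r]. *)

(** * Coordinates on the star *)

Section plane.
Variable R : realType.
Implicit Types (u w : Rcomplex R) (a b t : R).

Definition dot u w : R := complex.Re u * complex.Re w + complex.Im u * complex.Im w.

Lemma norm_Rcomplex w : `|w| = Num.sqrt (complex.Re w ^+ 2 + complex.Im w ^+ 2).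
Proof. by case: w. Qed.

Lemma dotB u w1 w2 : dot u (w1 - w2) = dot u w1 - dot u w2.
Proof. by case: w1 w2 => [a b] [c d]; rewrite /dot/=; ring. Qed.

Lemma dot_le u w : `|dot u w| <= `|u| * `|w|.
Proof.
rewrite !norm_Rcomplex -sqrtrM ?addr_ge0 ?sqr_ge0// -sqrtr_sqr.
rewrite ler_sqrt ?mulr_ge0 ?addr_ge0 ?sqr_ge0//.
rewrite -subr_ge0 /dot.
rewrite (_ : _ - _ =
  (complex.Re u * complex.Im w - complex.Im u * complex.Re w) ^+ 2) ?sqr_ge0//.
ring.
Qed.

Lemma norm_scale_cis t a : `|t *: cis a| = `|t|.
Proof.
rewrite norm_Rcomplex /= !exprMn -mulrDr cos2Dsin2 mulr1.
exact: sqrtr_sqr.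
Qed.

Lemma norm_cis a : `|cis a| = 1 :> R.
Proof. by rewrite -[cis a]scale1r norm_scale_cis normr1. Qed.

Lemma dot_cis a t b : dot (cis a) (t *: cis b) = t * cos (a - b).
Proof. by rewrite /dot/= cosB; ring. Qed.

End plane.

Section star_geometry.
Variable R : realType.
Implicit Types (z : int) (s t : R) (x y : star R).

Definition len z : R := (absz z).+1%:R^-1.

Definition ang z : R :=
  match z with Posz n => pi - pi / n.+2%:R | Negz n => pi / n.+3%:R end.

Lemma plane_arcE z : plane_arc z = [set t *: cis (ang z) | t in `[0, len z]].
Proof. by case: z. Qed.

Lemma len_gt0 z : 0 < len z. Proof. by rewrite invr_gt0. Qed.

Lemma len_le1 z : len z <= 1.
Proof. by rewrite invf_le1// ler1n. Qed.

Lemma ang_ge0 z : 0 <= ang z.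
Proof.
have p0 := pi_gt0 R; case: z => n /=; last by rewrite divr_ge0 ?(ltW p0).
by rewrite subr_ge0 ler_pdivrMr// ler_peMr ?(ltW p0)// ler1n.
Qed.

Lemma ang_le_pi z : ang z <= pi.
Proof.
have p0 := pi_gt0 R; case: z => n /=; last first.
  by rewrite ler_pdivrMr// ler_peMr ?(ltW p0)// ler1n.
by rewrite gerBl divr_ge0 ?(ltW p0).
Qed.

Lemma ang_lt z1 z2 : z1 < z2 -> ang z1 < ang z2.
Proof.
have p0 := pi_gt0 R.
case: z1 z2 => m [] n //=.
- by rewrite ltz_nat => mn; rewrite ltrD2l ltrN2 ltr_pM2l// ltf_pV2 ?posrE// ltr_nat.
- move=> _; have h2 : (n.+2%:R^-1 <= 2^-1 :> R) by rewrite lef_pV2 ?posrE// ler_nat.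
  have h3 : (m.+3%:R^-1 <= 3^-1 :> R) by rewrite lef_pV2 ?posrE// ler_nat.
  move: (_ / m.+3%:R) (ler_wpM2l (ltW p0) h3) => b.
  move: (_ / n.+2%:R) (ler_wpM2l (ltW p0) h2) => a; lra.
- move=> mn; rewrite ltr_pM2l// ltf_pV2 ?posrE// ltr_nat; lia.
Qed.

(** The angles increase strictly with [z], so the two neighbouring rays are the nearest ones and the
    gap is positive. *)
Definition gap z : R := Num.min (ang (z + 1) - ang z) (ang z - ang (z - 1)).

Lemma gap_gt0 z : 0 < gap z.
Proof. by rewrite lt_min !subr_gt0 !ang_lt//; lia. Qed.

Lemma gap_le_pi z : gap z <= pi.
Proof.
rewrite ge_min; apply/orP; left.
by have := ang_ge0 z; have := ang_le_pi (z + 1); lra.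
Qed.

Lemma gap_le z1 z2 : z1 != z2 -> gap z1 <= `|ang z1 - ang z2|.
Proof.
have ang_le z z' : z <= z' -> ang z <= ang z'.
  by rewrite le_eqVlt => /orP[/eqP->//|/ang_lt/ltW].
rewrite neq_lt => /orP[] z12; rewrite ge_min; apply/orP; [left|right].
  rewrite distrC (le_trans _ (ler_norm _))// lerD2r ang_le//; lia.
rewrite (le_trans _ (ler_norm _))// lerD2l lerN2 ang_le//; lia.
Qed.

Definition cosgap z : R := cos (gap z).

Lemma cosgap_lt1 z : cosgap z < 1.
Proof.
rewrite /cosgap -cos0 ltr_cos ?in_itv/= ?lexx ?pi_ge0//; first exact: gap_gt0.
by rewrite gap_le_pi ltW// gap_gt0.
Qed.

Lemma cos_ang z1 z2 : z1 != z2 -> cos (ang z1 - ang z2) <= cosgap z1.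
Proof.
move=> z12.
rewrite -cos_norm /cosgap leNgt ltr_cos ?in_itv/= ?gap_le_pi ?(ltW (gap_gt0 _))//.
  by rewrite -leNgt gap_le.
rewrite normr_ge0/= ler_norml.
have := ang_ge0 z1; have := ang_ge0 z2.
by have := ang_le_pi z1; have := ang_le_pi z2; lra.
Qed.

(* Off the ray of angle [ang z] the other rays satisfy
   [dot (cis (ang z)) w <= cosgap z * `|w|], so the numerator vanishes there,
   whereas on that ray it is [(1 - cosgap z) * `|w|]. *)
Definition plane_height z (w : Rcomplex R) : R :=
  Num.max 0 (dot (cis (ang z)) w - cosgap z * `|w|) /
    ((1 - cosgap z) * len z).

Definition height z x : R := plane_height z (\val x).

Definition lip z : R := 2 / ((1 - cosgap z) * len z).

Lemma lip_gt0 z : 0 < lip z.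
Proof. by rewrite divr_gt0 ?mulr_gt0 ?len_gt0// subr_gt0 cosgap_lt1. Qed.

Lemma mdist_star x y : mdist x y = `|\val x - \val y|.
Proof. by []. Qed.

(** The maximum with 0, the dot product with a unit vector and the norm are each 1-Lipschitz, and
    [cosgap] is at most 1 in absolute value: whence the 2 in [lip]. *)
Lemma height_lip z x y : `|height z x - height z y| <= lip z * mdist x y.
Proof.
rewrite mdist_star /height /plane_height /lip.
set v := \val x; set w := \val y.
have max_lip a b : `|Num.max 0 a - Num.max 0 b| <= `|a - b| :> R.
  by case: (ler0P a) => ?; case: (ler0P b) => ?; rewrite ler_norml;
    case: (ler0P (a - b)) => ?; lra.
set c := (1 - _) * _.
have c0 : 0 < c by rewrite mulr_gt0 ?len_gt0// subr_gt0 cosgap_lt1.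
rewrite -mulrBl normrM normfV (gtr0_norm c0) mulrAC ler_pM2r ?invr_gt0//.
apply: le_trans (max_lip _ _) _.
have -> : dot (cis (ang z)) v - cosgap z * `|v| -
  (dot (cis (ang z)) w - cosgap z * `|w|) =
  dot (cis (ang z)) (v - w) - cosgap z * (`|v| - `|w|) :> R.
  by rewrite dotB; ring.
apply: le_trans (ler_normB _ _) _.
rewrite mulr_natl mulr2n lerD//.
  by rewrite (le_trans (dot_le _ _))// norm_cis mul1r.
rewrite normrM (le_trans _ (ler_dist_dist _ _))// ler_piMl//.
by rewrite ler_norml cos_geN1 cos_le1.
Qed.

(** Clamping makes [pt z] total and continuous on the real line, so that intervals can be mapped
    into the star. *)
Definition clamp s : R := Num.max 0 (Num.min 1 s).

Lemma clamp_itv s : 0 <= clamp s <= 1.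
Proof.
by rewrite le_max lexx ge_max ler01 ge_min lexx.
Qed.

Lemma clamp_id s : 0 <= s <= 1 -> clamp s = s.
Proof. by move=> /andP[s0 s1]; rewrite /clamp min_r// max_r. Qed.

Lemma clamp_lip s t : `|clamp s - clamp t| <= `|s - t|.
Proof.
have h1 := ler_norm (s - t); have := ler_norm (t - s); rewrite distrC => h2.
rewrite ler_norml /clamp !maxEle !minEle.
case: (leP 1 s) => ?; case: (leP 1 t) => ?; rewrite ?ler01;
  case: (leP 0 s) => ?; case: (leP 0 t) => ?; apply/andP; split; lra.
Qed.

Lemma star_pt_subproof z s : star_set ((clamp s * len z) *: cis (ang z)).
Proof.
exists z => //; rewrite plane_arcE; exists (clamp s * len z) => //=.
have /andP[s0 s1] := clamp_itv s.
by rewrite in_itv/= mulr_ge0 ?(ltW (len_gt0 z))//= ler_piMl ?(ltW (len_gt0 z)).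
Qed.

Definition pt z s : star R :=
  exist _ ((clamp s * len z) *: cis (ang z)) (mem_set (star_pt_subproof z s)).

Lemma val_pt z s : 0 <= s <= 1 -> \val (pt z s) = (s * len z) *: cis (ang z).
Proof. by move=> s01; rewrite /= clamp_id. Qed.

Lemma ptP x : exists z, exists2 s, 0 <= s <= 1 & x = pt z s.
Proof.
have [z _] := set_valP x; rewrite plane_arcE => -[t /= + tx].
rewrite in_itv/= => /andP[t0 tz]; exists z, (t / len z).
  by rewrite divr_ge0 ?(ltW (len_gt0 z))//= ler_pdivrMr ?len_gt0// mul1r.
apply: val_inj; rewrite val_pt ?divfK ?gt_eqF ?len_gt0//.
by rewrite divr_ge0 ?(ltW (len_gt0 z))//= ler_pdivrMr ?len_gt0// mul1r.
Qed.

Lemma pt0 z : pt z 0 = star0 R.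
Proof. by apply: val_inj; rewrite val_pt ?lexx ?ler01// mul0r scale0r. Qed.

Lemma height_pt z s : 0 <= s <= 1 -> height z (pt z s) = s.
Proof.
move=> s01; rewrite /height /plane_height val_pt// dot_cis subrr cos0 mulr1.
have h : 0 <= s * len z by rewrite mulr_ge0 ?(ltW (len_gt0 z))//; lra.
rewrite norm_scale_cis ger0_norm//.
have c0 : 0 < 1 - cosgap z by rewrite subr_gt0 cosgap_lt1.
have -> : s * len z - cosgap z * (s * len z) = (1 - cosgap z) * (s * len z).
  by ring.
rewrite max_r; last by apply: mulr_ge0 => //; exact: ltW.
by rewrite mulrCA mulfK// gt_eqF// mulr_gt0 ?len_gt0.
Qed.

Lemma height_pt_neq z z' s : 0 <= s <= 1 -> z != z' -> height z (pt z' s) = 0.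
Proof.
move=> s01 zz'; rewrite /height /plane_height val_pt// dot_cis.
have h : 0 <= s * len z' by rewrite mulr_ge0 ?(ltW (len_gt0 z'))//; lra.
rewrite norm_scale_cis ger0_norm// max_l ?mul0r//.
by rewrite mulrC -mulrBl mulr_le0_ge0// subr_le0 cos_ang.
Qed.

Lemma height0 z : height z (star0 R) = 0.
Proof. by rewrite -(pt0 z) height_pt// lexx ler01. Qed.

Lemma height_itv z x : 0 <= height z x <= 1.
Proof.
have [z' [s s01 ->]] := ptP x.
have [<-|zz'] := eqVneq z z'; first by rewrite height_pt.
by rewrite height_pt_neq// lexx ler01.
Qed.

(** Since [height z] vanishes on every other arc, each of its positive levels is a single point. *)
Lemma height_gt0 z x : 0 < height z x -> x = pt z (height z x).
Proof.
have [z' [s s01 ->]] := ptP x.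
have [<-|zz'] := eqVneq z z'; first by rewrite height_pt.
by rewrite height_pt_neq// ltxx.
Qed.

Lemma height_inj x y : (forall z, height z x = height z y) -> x = y.
Proof.
have [z [s s01 ->]] := ptP x => h.
have [s0|s0] := eqVneq s 0.
  rewrite s0 pt0; have [z' [s' s'01 yE]] := ptP y.
  have := h z'; rewrite s0 pt0 height0 yE height_pt// => <-.
  by rewrite pt0.
have := h z; rewrite height_pt// => sE.
by rewrite (@height_gt0 z y) -sE//; lra.
Qed.

Lemma mdist_pt z s t : 0 <= s <= 1 -> 0 <= t <= 1 ->
  mdist (pt z s) (pt z t) = `|s - t| * len z.
Proof.
move=> s01 t01; rewrite mdist_star !val_pt// -scalerBl norm_scale_cis.
by rewrite -mulrBl normrM (gtr0_norm (len_gt0 z)).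
Qed.

Lemma mdist_pt0 z s : 0 <= s <= 1 -> mdist (pt z s) (star0 R) = s * len z.
Proof.
move=> s01; rewrite -(pt0 z) mdist_pt ?lexx ?ler01// subr0 ger0_norm//.
by case/andP: s01.
Qed.

End star_geometry.

(** * Topology of the star *)

Section metric_facts.
Variable R : realType.

Lemma nbhs_metric (T : metricType R) (x : T) (A : set T) :
  nbhs x A <-> exists2 e : R, 0 < e & forall y, mdist x y < e -> A y.
Proof.
split=> [/metricType_numDomainType.nbhs_mdistP[e /= e0 eA]|[e e0 eA]].
  by exists e.
by apply/metricType_numDomainType.nbhs_mdistP; exists e.
Qed.

Lemma continuous_metric (T U : metricType R) (f : T -> U) (x : T) :
  (forall e : R, 0 < e ->
     exists2 d : R, 0 < d & forall y, mdist x y < d -> mdist (f x) (f y) < e) ->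
  {for x, continuous f}.
Proof.
move=> h; apply/metricType_numDomainType.cvgrPdist_lt => e /h[d d0 dP].
by apply/nbhs_metric; exists d.
Qed.

Lemma lipschitz_continuous (T : metricType R) (f : T -> R) (k : R) :
  0 < k -> (forall x y, `|f x - f y| <= k * mdist x y) -> continuous f.
Proof.
move=> k0 fk x; apply/cvgrPdist_lt => e e0; apply/nbhs_metric.
exists (e / k); first by rewrite divr_gt0.
by move=> y xy; rewrite (le_lt_trans (fk _ _))// mulrC -ltr_pdivlMr.
Qed.

Lemma set_val_continuous (T : metricType R) (A : set T) :
  continuous (set_val : set_type A -> T).
Proof. by move=> x; apply: continuous_metric => e e0; exists e. Qed.

End metric_facts.

Section star_topology.
Variable R : realType.
Implicit Types (z : int) (s t : R) (x y : star R).

Lemma height_continuous z : continuous (@height R z).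
Proof. exact: lipschitz_continuous (lip_gt0 _ z) (height_lip z). Qed.

Lemma pt_clamp z s : pt z s = pt z (clamp s).
Proof. by apply: val_inj; rewrite /= [clamp (clamp s)]clamp_id// clamp_itv. Qed.

Lemma pt_continuous z : continuous (@pt R z).
Proof.
move=> s; apply/metricType_numDomainType.cvgrPdist_lt => e e0; near=> t.
rewrite (pt_clamp z s) (pt_clamp z t) mdist_pt ?clamp_itv//.
apply: (@le_lt_trans _ _ (`|clamp s - clamp t|)).
  by rewrite ler_piMr// len_le1.
apply: (@le_lt_trans _ _ `|s - t|); last by near: t; exact: cvgr_dist_lt.
exact: clamp_lip.
Unshelve. all: by end_near. Qed.

(** Such a set is a union of images of intervals, all containing the origin. *)
Lemma connected_star_shaped (A : set (star R)) : A (star0 R) ->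
  (forall z s t, 0 <= t <= s -> s <= 1 -> A (pt z s) -> A (pt z t)) ->
  connected A.
Proof.
move=> A0 Ast.
pose P := [set zs : int * R | 0 <= zs.2 <= 1 /\ A (pt zs.1 zs.2)].
have -> : A = \bigcup_(zs in P) (pt zs.1 @` `[0, zs.2]).
  apply/seteqP; split => [x Ax|_ [[z s] /= [/= s01 As] [t + <-]]].
    have [z [s s01 xE]] := ptP x; exists (z, s); first by split => //; rewrite -xE.
    by exists s => //=; rewrite in_itv/= lexx andbT; lra.
  by rewrite /= in_itv/= => ts; apply: (Ast z s) => //; lra.
apply: bigcup_connected.
  exists (star0 R) => -[z s] [/= s01 _]; exists 0; last exact: pt0.
  by rewrite /= in_itv/= lexx; lra.
move=> [z s] _ /=; apply: connected_continuous_connected.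
  by apply/connected_intervalP; exact: interval_is_interval.
by apply: continuous_subspaceT; exact: pt_continuous.
Qed.

Lemma len_small (e : R) : 0 < e ->
  exists N : nat, forall z, (N <= absz z)%N -> len R z < e.
Proof.
move=> e0; exists (Num.truncn e^-1) => z Nz.
rewrite /len invf_plt ?posrE//.
apply: lt_le_trans (truncnS_gt _) _.
by rewrite ler_nat ltnS.
Qed.

(** A filter that does not cluster at 0 has a member avoiding a neighbourhood of 0. As the arcs
    shrink, this member lies in finitely many of them, each compact. *)
Lemma star_compact : compact [set: star R].
Proof.
move=> F PF FT; apply: contrapT => noc.
have : ~ cluster F (star0 R) by move=> c; apply: noc; exists (star0 R).
move=> /existsNP[A] /existsNP[V] /not_implyP[FA] /not_implyP[/nbhs_metric[e e0 eV]].
move=> /nonemptyPn AV.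
have [N NP] := len_small e0.
pose r := [seq k%:Z - N%:Z | k <- iota 0 N.*2.+1].
pose B : set (star R) := \big[setU/set0]_(z <- r) (@pt R z @` `[0, 1]).
have AB : A `<=` B.
  move=> x Ax; have [z [s s01 xE]] := ptP x.
  rewrite /B -bigcup_seq; exists z; last by exists s.
  rewrite /=; have [/NP zN|zN] := leqP N (absz z).
    have : (A `&` V) x.
      split => //; apply: eV; rewrite metric_sym xE mdist_pt0//.
      by rewrite (le_lt_trans _ zN)// ler_piMl ?(ltW (len_gt0 _ _))//; lra.
    by rewrite AV.
  apply/mapP; exists (absz (z + N%:Z)); last by lia.
  by rewrite mem_iota; lia.
have cB : compact B.
  apply: bigsetU_compact => z _; apply: continuous_compact.
    by apply: continuous_subspaceT; exact: pt_continuous.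
  exact: segment_compact.
have FB : F B by apply: filterS FA.
have [x [_ Fx]] := cB F PF FB.
by apply: noc; exists x.
Qed.

Lemma star_connected : connected [set: star R].
Proof. exact: connected_star_shaped. Qed.

Lemma star_continuum : continuum [set: star R].
Proof.
by split; [exists (star0 R)|exact: star_compact|exact: star_connected].
Qed.

Lemma open_mdist_lt (T : metricType R) (x : T) (e : R) :
  open [set y | mdist x y < e].
Proof.
rewrite openE => y /= xy; apply/nbhs_metric; exists (e - mdist x y).
  by rewrite subr_gt0.
by move=> z yz /=; have := metric_triangle x y z; lra.
Qed.

(** Balls around the origin are star-shaped; around any other point, a narrow band of heights is the
    image of an interval. *)
Lemma star_locally_connected : locally_connected (star R).
Proof.
move=> x U; have [z [s s01 xE]] := ptP x.
have [s0 /nbhs_metric[e e0 eU]|s0] := eqVneq s 0.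
  exists [set y | mdist x y < e]; split => //=; first exact: open_mdist_lt.
    by rewrite mdistxx.
  rewrite xE s0 pt0; apply: connected_star_shaped; first by rewrite /= mdistxx.
  move=> z' u t tu u1 /=; rewrite !(metric_sym (star0 _)) !mdist_pt0; try lra.
  by apply: le_lt_trans; rewrite ler_wpM2r ?(ltW (len_gt0 _ _))//; lra.
rewrite xE => /(@pt_continuous z s); rewrite /= => /nbhs_ballP[d /= d0 dU].
(* The lower level is kept nonnegative: heights above it are positive, which confines the band to
   the arc [z]. *)
pose a := Num.max 0 (s - d).
have a0 : 0 <= a by rewrite le_max lexx.
have ad : s - d <= a by rewrite le_max lexx orbT.
have as_ : a < s by rewrite gt_max; lra.
have hE y : (a < height z y < s + d) -> y = pt z (height z y).
  by move=> h; apply: height_gt0; lra.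
exists [set y | a < height z y < s + d]; split => //=.
- have -> : [set y : star R | a < height z y < s + d] =
      height z @^-1` `]a, s + d[ by apply/seteqP; split => y /=; rewrite in_itv.
  apply: open_comp; last exact: interval_open.
  by move=> y _; exact: height_continuous.
- by rewrite height_pt//; lra.
- have -> : [set y | a < height z y < s + d] =
      pt z @` [set t | a < t < s + d /\ t <= 1].
    apply/seteqP; split => [y /= h|_ [t /= [at_ t1] <-]].
      by exists (height z y); [have := height_itv z y; lra|exact/esym/hE].
    by rewrite height_pt//; lra.
  apply: connected_continuous_connected.
    by apply/connected_intervalP => u v /= ? ? w; lra.
  by apply: continuous_subspaceT; exact: pt_continuous.
- move=> y /= h; rewrite (hE y h); apply: dU; rewrite /ball/= ltr_norml; lra.
Qed.

End star_topology.

(** * Absence of simple closed curves *)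

Section no_circle.
Variable R : realType.
Implicit Types (s t a b : R).

(** Equality would give cos (b - a) = 1, but this cosine is 1 - 2 sin^2 ((b - a) / 2) and the half
    angle lies strictly between 0 and pi. *)
Lemma cis_neq a b : a < b -> b < a + pi *+ 2 -> cis a <> cis b.
Proof.
move=> ab ba [ca sa].
have c1 : cos (b - a) = 1.
  by rewrite cosB -ca -sa -!expr2 cos2Dsin2.
pose x := (b - a) / 2.
have x0 : 0 < sin x by apply: sin_gt0_pi; rewrite /x; lra.
have : cos (x *+ 2) = 1 by rewrite /x -mulr_natr divfK.
rewrite cos_mulr2n cos2sin2 => h; have := exprn_gt0 2 x0; lra.
Qed.

Lemma cisD2pi a : cis (a + pi *+ 2) = cis a :> Rcomplex R.
Proof. by rewrite /cis cosD2pi sinD2pi. Qed.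

Lemma circle_pt_subproof a : unit_circle R (cis a).
Proof. exact: norm_cis. Qed.

Definition circle_pt a : set_type (unit_circle R) :=
  exist _ (cis a : Rcomplex R) (mem_set (circle_pt_subproof a)).

Lemma circle_pt_continuous : continuous circle_pt.
Proof.
move=> a; apply/metricType_numDomainType.cvgrPdist_lt => e e0.
have e20 : 0 < e / 2 by rewrite divr_gt0.
have /cvgrPdist_lt/(_ _ e20) ccos := @continuous_cos R a.
have /cvgrPdist_lt/(_ _ e20) csin := @continuous_sin R a.
near=> b.
have -> : mdist (circle_pt a) (circle_pt b) = `|cis a - cis b| by [].
have h1 : `|cos a - cos b| < e / 2.
  near: b; exact: ccos.
have h2 : `|sin a - sin b| < e / 2.
  near: b; exact: csin.
rewrite norm_Rcomplex/=.
set x := cos a - cos b in h1 *; set y := sin a - sin b in h2 *.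
apply: (@le_lt_trans _ _ (`|x| + `|y|)); last by lra.
rewrite -[leRHS]ger0_norm ?addr_ge0// -[leRHS]sqrtr_sqr ler_sqrt ?sqr_ge0//.
rewrite [leRHS]sqrrD !real_normK ?num_real// lerD2r lerDl.
by rewrite mulrn_wge0// mulr_ge0.
Unshelve. all: by end_near. Qed.

(* If [h] is the height of a nonconstant loop, both arcs of the circle cross an
   intermediate level, at points that injectivity forces to coincide. *)
Lemma star_no_simple_closed_curve :
  ~ exists A : set (star R), simple_closed_curve A.
Proof.
move=> [A [f [cf [g [_ fK _]]]]].
pose F (w : set_type (unit_circle R)) : star R := set_val (f w).
have cF : continuous (F \o circle_pt).
  move=> a; apply: continuous_comp; first exact: circle_pt_continuous.
  apply: continuous_comp; first exact: cf.
  exact: set_val_continuous.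
have Finj u v : F u = F v -> u = v.
  by move=> /val_inj /(congr1 g); rewrite !fK.
have [a [b [ab bpi Fab]]] : exists a b, [/\ a < b, b < a + pi *+ 2 &
    F (circle_pt a) <> F (circle_pt b)].
  exists 0, pi; have := pi_gt0 R => p0; split; [lra|lra|].
  by move=> /Finj /(congr1 val) /= /cis_neq; apply; lra.
have [z hz] : exists z, height z (F (circle_pt a)) <> height z (F (circle_pt b)).
  by apply/existsNP => h; apply: Fab; exact: height_inj.
pose h t := height z (F (circle_pt t)).
have ch : continuous h.
  by move=> t; apply: (continuous_comp (cF t)); exact: height_continuous.
have h2pi : h (a + pi *+ 2) = h a.
  rewrite /h; congr (height z (F _)); apply: val_inj; exact: cisD2pi.
have ha : 0 <= h a <= 1 := height_itv z _.
have hb : 0 <= h b <= 1 := height_itv z _.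
pose m := (h a + h b) / 2.
have cross c d : c < d -> (h c = h a /\ h d = h b) \/ (h c = h b /\ h d = h a) ->
    exists2 t, c < t < d & h t = m.
  move=> cd hcd.
  have [|t] := @IVT _ h c d m (ltW cd) (continuous_subspaceT ch).
    rewrite ge_min le_max /m; case: hcd => -[-> ->];
    by case: (leP (h a) (h b)) => ?; apply/andP; split; apply/orP;
      ((left; lra) || (right; lra)).
  rewrite in_itv/= => /andP[ct td] tm; exists t => //.
  rewrite !lt_neqAle ct td !andbT.
  have hab : h a <> h b by [].
  by apply/andP; split; apply/eqP => E; apply: hab; move: tm;
    [rewrite -E|rewrite E]; rewrite /m; case: hcd => -[hc hd];
    rewrite ?hc ?hd; lra.
have [t1 t1ab ht1] := cross a b ab (or_introl (conj erefl erefl)).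
have [t2 t2ab ht2] := cross b _ bpi (or_intror (conj erefl h2pi)).
(* Two distinct nonnegative heights have a positive mean, so [height_gt0] applies at both
   crossings. *)
have m0 : 0 < m.
  move: hz => /eqP; rewrite -/(h a) -/(h b) neq_lt /m => /orP[] ?; lra.
have E : circle_pt t1 = circle_pt t2.
  apply: Finj; rewrite (@height_gt0 _ z (F (circle_pt t1))) -/(h t1) ?ht1//.
  by rewrite (@height_gt0 _ z (F (circle_pt t2))) -/(h t2) ?ht2.
have /(congr1 val)/= := E; apply: cis_neq; lra.
Qed.

Lemma star_dendrite : dendrite (star R).
Proof.
split; [exact: star_continuum|exact: star_locally_connected|].
exact: star_no_simple_closed_curve.
Qed.

End no_circle.

(** * The shift map *)

Section star_shift_facts.
Variable R : realType.
Implicit Types (z k : int) (s t : R) (x y : star R).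

(** At the origin the chosen arc is arbitrary, but the height is 0 there, so [shift_by] does not
    depend on the choice. *)
Definition arc_of x : int := projT1 (cid (ptP x)).

Definition shift_by k x : star R := pt (arc_of x + k) (height (arc_of x) x).

Lemma shift_by_pt k z s : 0 <= s <= 1 -> shift_by k (pt z s) = pt (z + k) s.
Proof.
move=> s01; rewrite /shift_by /arc_of; case: cid => z' /= [s' s'01 E].
have hz : height z (pt z s) = s by rewrite height_pt.
have hz' : height z' (pt z s) = s' by rewrite E height_pt.
rewrite hz'; have [zz'|zz'] := eqVneq z' z; first by move: hz'; rewrite zz' hz => ->.
have -> : s' = 0 by rewrite -hz' height_pt_neq.
have -> : s = 0 by rewrite -hz E height_pt_neq// eq_sym.
by rewrite !pt0.
Qed.

Lemma shift_by0 k : shift_by k (star0 R) = star0 R.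
Proof. by rewrite -(pt0 _ 0) shift_by_pt ?lexx ?ler01// !pt0. Qed.

Lemma shift_byK k : cancel (shift_by k) (shift_by (- k)).
Proof.
by move=> x; have [z [s s01 ->]] := ptP x; rewrite !shift_by_pt// addrK.
Qed.

Lemma height_shift_by k z x : height z (shift_by k x) = height (z - k) x.
Proof.
have [z' [s s01 ->]] := ptP x; rewrite shift_by_pt//.
have [->|zz'] := eqVneq z (z' + k); first by rewrite addrK !height_pt.
by rewrite !height_pt_neq//; apply: contraNneq zz' => <-; rewrite subrK.
Qed.

(** This amounts to |z| + 1 <= (|k| + 1)(|z + k| + 1). It bounds the dilation of distances to the
    origin, hence gives continuity there. *)
Lemma len_shift z k : len R (z + k) <= (absz k).+1%:R * len R z.
Proof.
rewrite /len ler_pdivlMr// mulrC -ler_pdivlMr ?invr_gt0// invrK -natrM ler_nat.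
nia.
Qed.

Lemma shift_by_continuous k : continuous (shift_by k).
Proof.
move=> x; apply: continuous_metric => e e0.
have [z [s s01 xE]] := ptP x.
have [s0|s0] := eqVneq s 0.
  rewrite xE s0 pt0 shift_by0.
  exists (e / (absz k).+1%:R); first by rewrite divr_gt0.
  move=> y; have [z' [t t01 ->]] := ptP y.
  rewrite shift_by_pt// !(metric_sym (star0 _)) !mdist_pt0// => h.
  rewrite ltr_pdivlMr// in h; apply: le_lt_trans h.
  rewrite -mulrA; apply: ler_wpM2l; first by case/andP: t01.
  by rewrite mulrC len_shift.
have sp : 0 < s by case/andP: s01 => *; rewrite lt_neqAle eq_sym s0.
have hc : {for x, continuous (fun y => pt (z + k) (height z y))}.
  apply: (continuous_comp (@height_continuous R z x)).
  exact: pt_continuous.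
have [d1 d10 d1P] : exists2 d, 0 < d & forall y, mdist x y < d ->
    mdist (pt (z + k) (height z x)) (pt (z + k) (height z y)) < e.
  apply/nbhs_metric; have /metricType_numDomainType.cvgrPdist_lt := hc.
  exact.
have l0 := lip_gt0 R z.
(* Within s / lip of [x] the height on the arc [z] stays positive, so [y] lies on that arc and
   [shift_by k] agrees there with the continuous map of [hc]. *)
exists (Num.min d1 (s / lip R z)); first by rewrite lt_min d10 divr_gt0.
move=> y; rewrite lt_min => /andP[xy1 xy2].
have hy : 0 < height z y.
  have := height_lip z x y; rewrite {1}xE height_pt//.
  rewrite ltr_pdivlMr// mulrC in xy2 => /le_lt_trans/(_ xy2).
  by rewrite ltr_norml => /andP[_]; lra.
have := d1P _ xy1; rewrite {1}xE height_pt// -(shift_by_pt k z s01) -xE.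
by rewrite {2}(height_gt0 hy) shift_by_pt// height_itv.
Qed.

Lemma star_arcE z : star_arc R z = pt z @` `[0, 1].
Proof.
apply/seteqP; split => [x|_ [s /= + <-]]; rewrite /star_arc /=.
  rewrite plane_arcE => -[t /= + tx]; rewrite in_itv/= => /andP[t0 tz].
  have h : 0 <= t / len R z <= 1.
    by rewrite divr_ge0 ?(ltW (len_gt0 _ z))//= ler_pdivrMr ?len_gt0// mul1r.
  exists (t / len R z); first by rewrite /= in_itv.
  by apply: val_inj; rewrite val_pt// divfK ?gt_eqF ?len_gt0.
rewrite in_itv/= => s01; rewrite plane_arcE; exists (s * len R z).
  by rewrite /= in_itv/= mulr_ge0 ?ler_piMl ?(ltW (len_gt0 _ z))//; lra.
by rewrite clamp_id.
Qed.

Lemma ang_addz1_pos (n : nat) : ang R (n%:Z + 1) = pi - pi / n.+3%:R.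
Proof. by rewrite (_ : n%:Z + 1 = n.+1)//; lia. Qed.

Lemma ang_addz1_neg (n : nat) : ang R (Negz n + 1) = pi / n.+2%:R.
Proof.
case: n => [|n]; last by rewrite (_ : Negz n.+1 + 1 = Negz n)//; lia.
by rewrite (_ : Negz 0 + 1 = 0)//= [X in X - _](splitr pi) addrK.
Qed.

(** The two clauses treat the arcs [Negz n] and [Posz n], hence all arcs, and determine the map.
    Both are cases of one formula, [main], that rescales by the ratio of consecutive lengths. *)
Lemma star_shiftE (g : star R -> star R) : star_shift g <-> g = shift_by 1.
Proof.
split=> [gP|-> n]; last first.
  have main (z : int) t x : 0 <= t <= len R z -> \val x = t *: cis (ang R z) ->
      \val (shift_by 1 x) = (len R (z + 1) / len R z * t) *: cis (ang R (z + 1)).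
    move=> /andP[t0 tz] xE.
    have h : 0 <= t / len R z <= 1.
      by rewrite divr_ge0 ?(ltW (len_gt0 _ z))//= ler_pdivrMr ?len_gt0// mul1r.
    have -> : x = pt z (t / len R z).
      by apply: val_inj; rewrite val_pt// divfK ?gt_eqF ?len_gt0.
    by rewrite shift_by_pt// val_pt//; congr (_ *: _); ring.
  have len_neg : len R (Negz n + 1) = n.+1%:R^-1.
    by rewrite /len (_ : absz (Negz n + 1) = n)//; lia.
  have len_pos : len R (n%:Z + 1) = n.+2%:R^-1.
    by rewrite /len (_ : absz (n%:Z + 1) = n.+1)//; lia.
  split=> t x t01 xE.
    by rewrite (main (Negz n) t) // len_neg ang_addz1_neg /len invrK [_^-1 * _]mulrC.
  by rewrite (main (Posz n) t) // len_pos ang_addz1_pos /len invrK [_^-1 * _]mulrC.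
apply/funext => x; have [z [s s01 ->]] := ptP x.
rewrite shift_by_pt//; apply: val_inj; rewrite val_pt//.
have s0 : 0 <= s * len R z <= len R z.
  by rewrite mulr_ge0 ?ler_piMl ?(ltW (len_gt0 _ z))//; lra.
case: z s0 => n s0.
  have [_ /(_ (s * len R n) (pt n s) s0)] := gP n.
  rewrite val_pt// => /(_ erefl) ->; rewrite ang_addz1_pos; congr (_ *: _).
  rewrite /len (_ : absz (n%:Z + 1) = n.+1); last lia.
  by rewrite mulrC -mulrA mulKf ?pnatr_eq0.
have [/(_ (s * len R (Negz n)) (pt (Negz n) s) s0) + _] := gP n.
rewrite val_pt// => /(_ erefl) ->; rewrite ang_addz1_neg; congr (_ *: _).
rewrite /len (_ : absz (Negz n + 1) = n); last lia.
by rewrite [absz _]/= mulrC -mulrA mulKf ?pnatr_eq0.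
Qed.

Lemma shift_by_homeomorphism k : homeomorphism (shift_by k).
Proof.
split; first exact: shift_by_continuous.
exists (shift_by (- k)); split; first exact: shift_by_continuous.
  exact: shift_byK.
by rewrite -{2}(opprK k); exact: shift_byK.
Qed.

Lemma fixed_points_shift_by1 : fixed_points (shift_by 1) = [set star0 R].
Proof.
apply/seteqP; split => [x|_ ->]; last exact: shift_by0.
rewrite /fixed_points/=; have [z [s s01 ->]] := ptP x.
rewrite shift_by_pt// => /(congr1 (height z)).
by rewrite height_pt_neq ?height_pt//; [move=> <-; rewrite pt0|lia].
Qed.

Lemma shift_by_arc k z : shift_by k @` star_arc R z = star_arc R (z + k).
Proof.
rewrite !star_arcE image_comp; apply: eq_imagel => s /=.
by rewrite in_itv => /shift_by_pt.
Qed.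

Lemma iter_shift_by1 (j : nat) z s : 0 <= s <= 1 ->
  iter j (shift_by 1) (pt z s) = pt (z + j%:Z) s.
Proof.
move=> s01; elim: j => [|j IH] /=; first by rewrite addr0.
by rewrite IH shift_by_pt//; congr pt; lia.
Qed.

Lemma iter_shift_by1_0 (j : nat) : iter j (shift_by 1) (star0 R) = star0 R.
Proof. by elim: j => //= j ->; rewrite shift_by0. Qed.

Lemma shift_by1_asymptotic x : asymptotic (shift_by 1) x (star0 R).
Proof.
apply: (cvg_limn_einf_sup _).2.
apply: cvg_EFin; first by near=> n.
apply/cvgrPdist_lt => e e0.
have [z [s s01 ->]] := ptP x.
have [N NP] := len_small e0.
exists (N + absz z)%N => // k /= Nk.
rewrite iter_shift_by1_0 iter_shift_by1// mdist_pt0// sub0r normrN.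
have l0 := len_gt0 R (z + k%:Z).
rewrite ger0_norm; last by rewrite mulr_ge0 ?(ltW l0)//; lra.
apply: le_lt_trans (NP (z + k%:Z) _); last lia.
by rewrite ler_piMl ?(ltW l0)//; lra.
Unshelve. all: by end_near. Qed.

End star_shift_facts.

(** * Entropy of the shift map *)

Section counting_facts.
Variable R : realType.

(** As [counting] is infinite on infinite sets, finiteness is first pulled back along the
    injection. *)
Lemma counting_le_card (T : choiceType) (U : finType) (E : set T) (f : T -> U) :
  (forall x y, E x -> E y -> f x = f y -> x = y) ->
  (counting E <= (#|U|%:R : R)%:E)%E.
Proof.
move=> finj.
have finE : finite_set E.
  have -> : E = E `&` f @^-1` [set: U] by rewrite preimage_setT setIT.
  suff : finite_set ((fun x : E => f (set_val x)) @^-1` [set: U]).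
    move=> /(finite_image set_val); apply: sub_finite_set => x [Ex _].
    by exists (exist _ x (mem_set Ex)).
  apply: finite_preimage; last exact: finite_finset.
  move=> x y _ _ /finj xy; apply: val_inj; apply: xy; exact: set_valP.
rewrite /counting asboolT// lee_fin ler_nat.
rewrite -(size_map f) -(card_uniqP _) ?max_card//.
rewrite map_inj_in_uniq ?finmap.fset_uniq// => x y.
by rewrite !in_fset_set// !inE; exact: finj.
Qed.

Lemma card_le_counting (T : choiceType) (U : finType) (f : U -> T) :
  injective f -> ((#|U|%:R : R)%:E <= counting (range f))%E.
Proof.
move=> finj; rewrite /counting.
have finf : finite_set (range f) by apply: finite_image; exact: finite_finset.
rewrite asboolT// lee_fin ler_nat cardE -(size_map f).
apply: uniq_leq_size; first by rewrite map_inj_uniq// enum_uniq.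
by move=> _ /mapP[u _ ->]; rewrite in_fset_set// inE; exists u.
Qed.

End counting_facts.

Section entropy_facts.
Variables (R : realType) (Y : metricType R) (F : Y -> Y).
Implicit Types (e : R) (m : nat).

Lemma sep_ge1 m e (y : Y) : (1 <= sep F m e)%E.
Proof.
apply: (@le_trans _ _ (counting [set y])); last first.
  by apply: ereal_sup_ubound; exists [set y] => // u v -> ->.
rewrite /counting asboolT; last exact: finite_set1.
by rewrite fset_set1 finmap.cardfs1.
Qed.

Lemma entropy_at_ge e (c : \bar R) :
  (forall m, (0 < m)%N -> (c <= (m%:R^-1)%:E * lne (sep F m e))%E) ->
  (c <= entropy_at F e)%E.
Proof.
move=> cle; apply: le_ereal_inf_tmp => _ [V [N _ NV] <-].
apply: le_trans (cle N.+1 (ltn0Sn _)) _.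
by apply: ereal_sup_ubound; exists N.+1 => //; apply: NV => /=.
Qed.

(** A linear bound has exponential rate 0, because ln x <= b x - ln b for every b > 0. *)
Lemma entropy_at_eq0 e (y : Y) (C : nat) :
  (forall m, (sep F m e <= ((C * m.+1)%:R)%:E)%E) -> entropy_at F e = 0%E.
Proof.
move=> sepC; have C0 : (0 < C)%N.
  have := le_trans (sep_ge1 1 e y) (sepC 1%N).
  by rewrite lee_fin; case: C {sepC} => //; rewrite mul0n ler10.
apply/eqP; rewrite eq_le; apply/andP; split; last first.
  apply: entropy_at_ge => m m0; apply: mule_ge0; first by rewrite lee_fin.
  by rewrite lne_ge0 sep_ge1.
apply/lee_addgt0Pr => _/posnumP[d]; rewrite add0e.
(* This [b] makes b C (m + 1) at most d m / 2, and the threshold [N] makes - ln b at most d m / 2 as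
   well. *)
pose b : R := d%:num / (4 * C%:R).
have C0' : 0 < C%:R :> R by rewrite ltr0n.
have b0 : 0 < b by rewrite divr_gt0 ?mulr_gt0.
pose N := (Num.truncn (2 * `|ln b| / d%:num)).+1.
apply: (@le_trans _ _ (ereal_sup
  ((fun m => (m%:R^-1)%:E * lne (sep F m e)) @` [set m | (N <= m)%N])%E)).
  by apply: ereal_inf_lbound; exists [set m | (N <= m)%N] => //; exists N.
apply: ge_ereal_sup => _ [m /= Nm <-].
have m0 : 0 < m%:R :> R by rewrite ltr0n (leq_trans _ Nm).
have s0 : 0 < (C * m.+1)%:R :> R by rewrite ltr0n muln_gt0 C0.
apply: (@le_trans _ _ ((m%:R^-1)%:E * (ln (C * m.+1)%:R)%:E)%E).
  rewrite lee_wpmul2l ?lee_fin ?invr_ge0// -lne_EFin//.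
  rewrite lee_lne ?sepC// in_itv/= ?leey ?sep_ge0// andbT lee_fin; exact: ltW.
rewrite -EFinM lee_fin mulrC ler_pdivrMr//.
have lnle : ln (C * m.+1)%:R <= b * (C * m.+1)%:R - ln b.
  by rewrite lerBrDr addrC -lnM ?posrE// ltW// ln_sublinear// mulr_gt0.
have bm : b * (C * m.+1)%:R <= d%:num / 2 * m%:R.
  have -> : b * (C * m.+1)%:R = d%:num / 4 * m.+1%:R.
    by rewrite /b natrM; field; rewrite gt_eqF.
  have h : m.+1%:R <= 2 * m%:R :> R by rewrite -natrM ler_nat; lia.
  have -> : d%:num / 2 * m%:R = d%:num / 4 * (2 * m%:R) by field.
  by rewrite ler_wpM2l.
have lnb : - ln b <= d%:num / 2 * m%:R.
  rewrite (le_trans (ler_norm _))// normrN.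
  have : 2 * `|ln b| / d%:num <= m%:R.
    by rewrite (le_trans (ltW (truncnS_gt _)))// ler_nat.
  by rewrite ler_pdivrMr// => h; lra.
lra.
Qed.

End entropy_facts.

Section star_entropy.
Variable R : realType.

Lemma shift_by1_sep (e : R) : 0 < e -> exists C : nat, forall m,
  (sep (@shift_by R 1) m e <= ((C * m.+1)%:R)%:E)%E.
Proof.
move=> e0; have [N NP] : exists N : nat, forall z, (N <= absz z)%N -> len R z < e / 2.
  by apply: len_small; rewrite divr_gt0.
pose Q := Num.truncn e^-1.
exists (2 * N.+1 * Q.+2)%N => m.
(* [None] codes the arcs that stay within e / 2 of the origin at all times below [m]. A pair codes
   one of the 2 N + m other arcs and a cell of length [e] of heights. Points with equal codes are
   never separated. *)
pose U : finType := option ('I_(2 * N + m).+1 * 'I_Q.+1).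
apply: ge_ereal_sup => _ [E sE <-].
pose near0 (z : int) := (- (N + m)%:Z <= z) && (z < N%:Z).
pose f (x : star R) : U := let z := arc_of x in
  if near0 z then
    Some (inord (absz (z + (N + m)%:Z)), inord (Num.truncn (height z x / e)))
  else None.
have card_U : (#|U| <= 2 * N.+1 * Q.+2 * m.+1)%N.
  by rewrite card_option card_prod !card_ord; nia.
apply: (@le_trans _ _ (#|U|%:R)%:E); last by rewrite lee_fin ler_nat.
apply: (@counting_le_card _ _ U _ f) => x y Ex Ey fxy.
apply: contrapT => xy; have [j jm] := sE _ _ Ex Ey xy.
have ptE (w : star R) : w = pt (arc_of w) (height (arc_of w) w).
  rewrite /arc_of; case: cid => z /= [s s01 ->]; by rewrite height_pt.
move: fxy; rewrite /f /=.
have hx := height_itv (arc_of x) x; have hy := height_itv (arc_of y) y.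
rewrite [in mdist _ _](ptE x) [in mdist _ _](ptE y) !iter_shift_by1//.
move: (arc_of x) (arc_of y) hx hy => z z'.
move: (height z x) (height z' y) => s s' hs hs'.
have trunc_lt (t : R) : 0 <= t <= 1 -> (Num.truncn (t / e) < Q.+1)%N.
  move=> t01; rewrite ltnS /Q le_truncn//.
  by rewrite ler_piMl// ?invr_ge0 ?(ltW e0)//; case/andP: t01.
have far w t : 0 <= t <= 1 -> ~~ near0 w ->
    mdist (pt (w + j%:Z) t) (star0 R) < e / 2.
  move=> t01 nw; rewrite mdist_pt0//.
  apply: le_lt_trans (NP (w + j%:Z) _); last by rewrite /near0 in nw; lia.
  by rewrite ler_piMl ?(ltW (len_gt0 _ _))//; case/andP: t01.
case: ifPn => nz; case: ifPn => nz' //.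
  case=> /(congr1 val)/= zz /(congr1 val)/=.
  rewrite !inordK ?trunc_lt// => ss.
  have near_lt w : near0 w -> (absz (w + (N + m)%:Z)%R < (2 * N + m).+1)%N.
    by rewrite /near0; lia.
  move: zz; rewrite !inordK ?near_lt// => zz'.
  have {zz'}zz : z = z' by move: zz' nz nz'; rewrite /near0; lia.
  rewrite -zz mdist_pt// => lt_e.
  have : `|s - s'| < e.
    have [s0 s'0] : 0 <= s / e /\ 0 <= s' / e.
      by split; rewrite divr_ge0 ?(ltW e0)//; [case/andP: hs|case/andP: hs'].
    have := truncn_itv s0; have := truncn_itv s'0; rewrite ss -natr1.
    rewrite ler_pdivlMr// ltr_pdivrMr// ler_pdivlMr// ltr_pdivrMr// => h1 h2.
    rewrite ltr_norml; lra.
  move=> se; move: lt_e; apply/negP; rewrite -leNgt; apply: le_trans (ltW se).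
  by rewrite ler_piMr// len_le1.
move=> _; have h1 := far _ _ hs nz; have h2 := far _ _ hs' nz'.
have := metric_triangle (pt (z + j%:Z) s) (star0 R) (pt (z' + j%:Z) s').
rewrite (metric_sym (star0 R)); lra.
Qed.

Lemma shift_by1_entropy : entropy (@shift_by R 1) = 0%E.
Proof.
apply/cvg_lim => //; apply: (@cvg_near_cst _ _ _ _ _).
near=> e; have [C CP] : exists C : nat, forall m,
  (sep (@shift_by R 1) m e <= ((C * m.+1)%:R)%:E)%E by exact: shift_by1_sep.
exact: (entropy_at_eq0 (star0 R) CP).
Unshelve. all: by end_near. Qed.

End star_entropy.

(** * Combs and the entropy of the induced map *)

Section hausdorff_facts.
Variables (R : realType) (T : metricType R).

Lemma hausdorff_dist_le (A B : subcontinuum T) (e : R) :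
  hausdorff_radii A B e -> mdist A B <= e.
Proof. by move=> ABe; apply: ge_inf => //; exists 0 => x []; move/ltW. Qed.

Lemma le_hausdorff_dist (A B : subcontinuum T) (c : R) :
  (forall e, hausdorff_radii A B e -> c <= e) -> c <= mdist A B.
Proof.
move=> cle; apply: lb_le_inf; last by move=> e; exact: cle.
(* Boundedness of both compact sets supplies a radius, so the infimum is over a nonempty set. *)
have [[a Aa] cA _] := subcontinuumP A.
have [[b Bb] cB _] := subcontinuumP B.
have [M M0 MP] := compact_mdist_bounded b cA.
have [N N0 NP] := compact_mdist_bounded a cB.
exists (M + N); split; first exact: addr_gt0.
  by move=> x /MP Mx; exists b => //; rewrite metric_sym; lra.
by move=> x /NP Nx; exists a => //; rewrite metric_sym; lra.
Qed.

End hausdorff_facts.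

Section combs.
Variable R : realType.
Implicit Types (z : int) (s t e : R) (x y : star R) (a b : int -> R).

(** The absolute value puts the origin in every comb, so that any real function defines a
    continuum. *)
Definition comb_set a : set (star R) := [set x | forall z, height z x <= `|a z|].

Lemma comb_set_pt a z s : 0 <= s <= 1 -> comb_set a (pt z s) <-> s <= `|a z|.
Proof.
move=> s01; split=> [/(_ z)|sa z']; first by rewrite height_pt.
have [->|zz'] := eqVneq z' z; first by rewrite height_pt.
by rewrite height_pt_neq.
Qed.

Lemma comb_continuum a : continuum (comb_set a).
Proof.
have comb0 : comb_set a (star0 R) by move=> z; rewrite height0.
split; first by exists (star0 R).
  apply: (subclosed_compact _ (@star_compact R)) => //.
  have -> : comb_set a =
      \bigcap_(z in [set: int]) (height z @^-1` [set t : R | t <= `|a z|]).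
    by apply/seteqP; split => [x ax z _|x ax z]; [exact: ax|exact: ax].
  apply: closed_bigI => z _; apply: closed_comp; last exact: closed_le.
  by move=> x _; exact: height_continuous.
apply: connected_star_shaped => // z s t /andP[t0 ts] s1.
have t01 : 0 <= t <= 1 by lra.
have s01 : 0 <= s <= 1 by lra.
by rewrite !comb_set_pt//; exact: le_trans.
Qed.

Definition comb a : subcontinuum (star R) := Subcontinuum (comb_continuum a).

Lemma comb_inj a b : (forall z, 0 <= a z <= 1) -> (forall z, 0 <= b z <= 1) ->
  comb a = comb b -> a =1 b.
Proof.
move=> a01 b01 /(congr1 (@subcontinuum_set _)) /= ab z.
have /andP[az0 _] := a01 z; have /andP[bz0 _] := b01 z.
apply/eqP; rewrite eq_le; apply/andP; split.
  have : comb_set b (pt z (a z)) by rewrite -ab comb_set_pt// ger0_norm.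
  by rewrite comb_set_pt// ger0_norm.
have : comb_set a (pt z (b z)) by rewrite ab comb_set_pt// ger0_norm.
by rewrite comb_set_pt// ger0_norm.
Qed.

(** Cutting a point of one comb down to the tooth of the other moves it by at most |a z - b z| times
    the length of the arc, so far teeth count little. *)
Lemma comb_dist_le a b e : 0 < e ->
  (forall z, `|a z - b z| * len R z < e) -> mdist (comb a) (comb b) <= e.
Proof.
move=> e0 abe.
have close c d x : (forall z, `|c z - d z| * len R z < e) -> comb_set c x ->
    exists2 y, comb_set d y & mdist x y < e.
  move=> cde; have [z [s s01 ->]] := ptP x; rewrite comb_set_pt// => sc.
  have m01 : 0 <= Num.min s `|d z| <= 1.
    by rewrite le_min ge_min normr_ge0 andbT; case/andP: s01 => -> ->.
  exists (pt z (Num.min s `|d z|)).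
    by rewrite comb_set_pt// ge_min lexx orbT.
  rewrite mdist_pt//; apply: le_lt_trans (cde z).
  rewrite ler_wpM2r ?(ltW (len_gt0 _ _))//.
  have := lerB_dist (c z) (d z); have := normr_ge0 (c z - d z).
  by case: (leP s `|d z|) => ? ? ?; rewrite ler_norml; apply/andP; split; lra.
apply: hausdorff_dist_le; split => // x; apply: close => // z.
by rewrite distrC.
Qed.

(** The tip of the higher tooth is close to some point of the other comb, whose height on the arc
    [z] is at most the lower tooth, and [height z] is Lipschitz. *)
Lemma le_comb_dist a b z : 0 <= a z <= 1 -> 0 <= b z <= 1 ->
  `|a z - b z| <= lip R z * mdist (comb a) (comb b).
Proof.
move=> a01 b01; have l0 := lip_gt0 R z.
rewrite mulrC -ler_pdivrMr//; apply: le_hausdorff_dist => e [e0 AB BA].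
rewrite ler_pdivrMr//.
have close c d : 0 <= c z <= 1 -> 0 <= d z <= 1 ->
    (forall x, comb_set c x -> exists2 y, comb_set d y & mdist x y < e) ->
    c z - d z <= e * lip R z.
  move=> c01 d01 cd; have [|y /(_ z) dy ye] := cd (pt z (c z)).
    by rewrite comb_set_pt// ler_norm.
  rewrite ger0_norm in dy; last by case/andP: d01.
  have := height_lip z (pt z (c z)) y; rewrite height_pt//.
  have := ler_norm (c z - height z y).
  have : lip R z * mdist (pt z (c z)) y <= e * lip R z.
    by rewrite mulrC ler_wpM2r// ltW.
  lra.
rewrite ler_norml; have := close a b a01 b01 AB; have := close b a b01 a01 BA.
by move=> h1 h2; apply/andP; split; lra.
Qed.

Variable cg : continuous (@shift_by R 1).

Lemma induced_comb a : induced_map cg (comb a) = comb (fun z => a (z - 1)).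
Proof.
apply: subcontinuum_inj; apply/seteqP; split => [_ [x ax <-] z|x ax] /=.
  by rewrite height_shift_by.
exists (shift_by (- 1) x); last first.
  by rewrite -[X in shift_by X (shift_by _ _)]opprK shift_byK.
by move=> z; rewrite height_shift_by opprK; have := ax (z + 1); rewrite addrK.
Qed.

Lemma iter_induced_comb (k : nat) a :
  iter k (induced_map cg) (comb a) = comb (fun z => a (z - k%:Z)).
Proof.
elim: k => [|k IH] /=; first by congr comb; apply/funext => z; rewrite subr0.
rewrite IH induced_comb; congr comb; apply/funext => z; congr a; lia.
Qed.

(** Words of length m + 1 over the multiples of 1 / (K + 1) in [0, 1] give combs. At time [j] the
    arc 0 displays the letter [j], and distinct letters are farther apart than [lip R 0 * e]. *)
Lemma induced_sep_ge (K m : nat) e : 0 < e -> lip R 0 * e < K.+1%:R^-1 ->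
  (((K.+2 ^ m.+1)%:R)%:E <= sep (induced_map cg) m.+1 e)%E.
Proof.
move=> e0 eK.
pose U := {ffun 'I_m.+1 -> 'I_K.+2}.
(* The letter [j] sits on the arc -j, and also on its mirror image j; past the word, [inord] returns
   its default index 0. *)
pose h (u : U) (z : int) : R := (u (inord (absz z)))%:R / K.+1%:R.
have h01 u z : 0 <= h u z <= 1.
  by rewrite divr_ge0//= ler_pdivrMr// mul1r ler_nat -ltnS.
have sepU u v : u != v -> exists2 j, (j < m.+1)%N &
    e < mdist (iter j (induced_map cg) (comb (h u)))
              (iter j (induced_map cg) (comb (h v))).
  move=> uv; have [j juv] : exists j, u j != v j.
    apply/existsP; apply: contraNT uv; rewrite negb_exists => /forallP uv.
    by apply/eqP/ffunP => j; apply/eqP; have := uv j; rewrite negbK.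
  exists j => //; rewrite !iter_induced_comb.
  have hj w : h w (0 - (j : nat)%:Z) = (w j)%:R / K.+1%:R.
    by rewrite /h sub0r abszN inord_val.
  have := @le_comb_dist (fun z => h u (z - (j : nat)%:Z))
    (fun z => h v (z - (j : nat)%:Z)) 0 (h01 u _) (h01 v _).
  rewrite !hj -mulrBl normrM normfV (@ger0_norm _ K.+1%:R)// => duv.
  have l0 := lip_gt0 R 0.
  rewrite -(ltr_pM2l l0); apply: lt_le_trans eK _; apply: le_trans duv.
  rewrite ler_peMl ?invr_ge0//.
  have : (u j < v j)%N || (v j < u j)%N by rewrite -neq_ltn.
  move=> /orP[]; rewrite -(ler_nat R) -natr1 => uvj; rewrite ler_normr;
    apply/orP; [right|left]; lra.
have injf : injective (fun u => comb (h u)).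
  move=> u v E; apply/eqP; apply: contraT => /sepU[j _].
  by rewrite E mdistxx ltNge ltW.
have -> : (K.+2 ^ m.+1)%N = #|U| by rewrite card_ffun !card_ord.
apply: le_trans (card_le_counting R injf) _.
apply: ereal_sup_ubound; exists (range (fun u => comb (h u))) => //.
move=> _ _ [u _ <-] [v _ <-] uv; apply: sepU.
by apply: contra_not_neq uv => ->.
Qed.

Lemma induced_entropy : entropy (induced_map cg) = +oo%E.
Proof.
apply/eqyP => M _; apply: lime_ge; first exact: is_cvg_entropy_at.
(* With this [K], ln (K + 2) is at least [M]; then [e] is taken small enough to separate the K + 2
   grid values. *)
pose K := Num.truncn (expR M).
have l0 := lip_gt0 R 0.
near=> e; have e0 : 0 < e by near: e; exact: nbhs_right_gt.
have eK : lip R 0 * e < K.+1%:R^-1.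
  rewrite mulrC -ltr_pdivlMr//; near: e; apply: nbhs_right_lt.
  by rewrite divr_gt0.
apply: entropy_at_ge => -[//|m] _.
apply: (@le_trans _ _ ((m.+1%:R^-1)%:E * (ln (K.+2 ^ m.+1)%:R)%:E)%E); last first.
  rewrite lee_wpmul2l ?lee_fin ?invr_ge0// -lne_EFin ?ltr0n ?expn_gt0//.
  rewrite lee_lne ?induced_sep_ge// in_itv/= ?sep_ge0 leey ?andbT//.
rewrite -EFinM lee_fin natrX lnXn ?ltr0n// -[ln _ *+ _]mulr_natl mulKf ?pnatr_eq0//.
rewrite -(@expRK R M) ler_ln ?posrE ?expR_gt0//.
rewrite (le_trans (ltW (truncnS_gt _)))// ler_nat.
exact: leqnSn.
Unshelve. all: by end_near. Qed.

End combs.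

(** * Omega-chaos of the induced map *)

Section omega_chaos.
Variable R : realType.
Implicit Types (z : int) (r v e : R) (n l d : nat) (a b : int -> R).

(** Injectivity would carry countability back to the interval, whose Lebesgue measure is
    positive. *)
Lemma uncountable_image (T : Type) (f : R -> T) (u v : R) : u < v ->
  {in `[u, v[ &, injective f} -> ~ countable (f @` `[u, v[).
Proof.
move=> uv finj /countable_injP[h hinj].
have : countable [set` `[u, v[].
  apply/countable_injP; exists (h \o f) => x y xI yI /hinj xy.
  move: xI yI; rewrite !inE => xI yI; apply: finj => //; apply: xy.
    by rewrite inE; exists x.
  by rewrite inE; exists y.
move/countable_lebesgue_measure0; rewrite lebesgue_measure_itv/= lte_fin uv.
by move=> /eqP; rewrite -EFinB eqe subr_eq0 gt_eqF.
Qed.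

(* [dyadic l] runs through all dyadic rationals of [0, 1[, level by level:
   [dyadic (2 ^ q + p) = p / 2 ^ q] for [p < 2 ^ q]. *)
Definition dyadic l : R := `|l%:R / (2 ^ trunc_log 2 l)%:R - 1|.

Lemma dyadic_le1 l : dyadic l <= 1.
Proof.
rewrite /dyadic ler_norml.
have q0 : (0 : R) < (2 ^ trunc_log 2 l)%:R by rewrite ltr0n expn_gt0.
have : 0 <= l%:R / (2 ^ trunc_log 2 l)%:R :> R by rewrite divr_ge0.
have : l%:R / (2 ^ trunc_log 2 l)%:R <= 2%:R :> R.
  rewrite ler_pdivrMr// -natrM ler_nat -expnS ltnW//.
  exact: trunc_log_ltn.
by move=> ? ?; apply/andP; split; lra.
Qed.

Lemma dyadic_dense v e (L : nat) : 0 <= v < 1 -> 0 < e ->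
  exists2 l, (L <= l)%N & `|v - dyadic l| < e.
Proof.
(* At level [q] the grid step 1 / 2 ^ q is below [e], and 2 ^ q > q >= L makes the index large
   enough. *)
move=> /andP[v0 v1] e0; pose q := ((Num.truncn e^-1).+1 + L)%N.
have qE : q = ((Num.truncn e^-1).+1 + L)%N by [].
have qlt : (q < 2 ^ q)%N by rewrite ltn_expl.
have q0 : (0 : R) < (2 ^ q)%:R by rewrite ltr0n expn_gt0.
pose p := Num.truncn (v * (2 ^ q)%:R).
have vq0 : 0 <= v * (2 ^ q)%:R by rewrite mulr_ge0.
have /andP[pv vp] := truncn_itv vq0.
have pq : (p < 2 ^ q)%N.
  by rewrite -(ltr_nat R) (le_lt_trans pv)// gtr_pMl.
exists (2 ^ q + p)%N; first by clearbody q; lia.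
rewrite /dyadic (@trunc_log_eq 2 q (2 ^ q + p))//; last by rewrite expnS; lia.
rewrite natrD mulrDl divff ?gt_eqF// addrAC subrr add0r.
rewrite (@ger0_norm _ (p%:R / _)) ?divr_ge0//.
have -> : v - p%:R / (2 ^ q)%:R = (v * (2 ^ q)%:R - p%:R) / (2 ^ q)%:R.
  by rewrite mulrBl mulfK ?gt_eqF.
rewrite -natr1 in vp.
rewrite normrM normfV (gtr0_norm q0) ltr_pdivrMr//.
apply: (@le_lt_trans _ _ 1); first by rewrite ler_norml; apply/andP; split; lra.
rewrite mulrC -ltr_pdivrMr// mul1r (lt_trans (truncnS_gt _))// ltr_nat.
by rewrite (leq_ltn_trans _ qlt)// leq_addr.
Qed.

(* Isolated pairs [r, dyadic l / 3] at the sparse times [2 ^ l], [2 ^ l + 1]: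
   the limit points of the shifts are the spikes below and their translates,
   and the zero sequence. *)
Definition pulses r n : R :=
  let l := trunc_log 2 n in let d := (n - 2 ^ l)%N in
  if d == 0%N then r else if d == 1%N then dyadic l / 3 else 0.

Lemma pulsesE r l d : (d < 2 ^ l)%N -> pulses r (2 ^ l + d) =
  if d == 0%N then r else if d == 1%N then dyadic l / 3 else 0.
Proof.
move=> dl; rewrite /pulses (@trunc_log_eq 2 l (2 ^ l + d))//; first by rewrite addKn.
by rewrite expnS; lia.
Qed.

(** For r >= 1/2 the value [r] is thus at distance at least 1/6 from every other value of any pulse
    sequence with parameter other than [r], save that parameter itself. *)
Lemma pulses_value r n :
  pulses r n = r \/ 0 <= pulses r n <= 3^-1.
Proof.
rewrite /pulses /=; case: ifP => _; first by left.
right; case: ifP => _; last by rewrite lexx invr_ge0 ler0n.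
have := dyadic_le1 (trunc_log 2 n).
have : 0 <= dyadic (trunc_log 2 n) by exact: normr_ge0.
by move=> ? ?; apply/andP; split; lra.
Qed.

Lemma pulses_itv r n : 2^-1 <= r <= 1 -> 0 <= pulses r n <= 1.
Proof. by move=> r1; case: (pulses_value r n) => [->|]; lra. Qed.

(** After a shift by 2 ^ l the arc [z] shows the entry of index |z - 2 ^ l|, so the second pulse, at
    2 ^ l + 1, appears on the arc -1. *)
Definition spike r v z : R :=
  if z == 0 then r else if z == - 1 then v / 3 else 0.

Lemma spike_itv r v z : 2^-1 <= r <= 1 -> 0 <= v < 1 -> 0 <= spike r v z <= 1.
Proof. by move=> r1 v1; rewrite /spike; case: ifP => _; [|case: ifP => _]; lra. Qed.

Definition pulse_comb r : subcontinuum (star R) := comb (fun z => pulses r (absz z)).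

Variable cg : continuous (@shift_by R 1).

(** Approximation on finite windows of arcs suffices, since the arcs outside a large window are
    short. *)
Lemma omega_limit_comb a b :
  (forall z, 0 <= a z <= 1) -> (forall z, 0 <= b z <= 1) ->
  (forall (n N : nat) e, 0 < e -> exists2 k : nat, (n <= k)%N &
     forall z, (absz z < N)%N -> `|b z - a (z - k%:Z)| < e) ->
  omega_limit (induced_map cg) (comb a) (comb b).
Proof.
move=> a01 b01 ab n /= _ V /nbhs_metric[e e0 eV].
have e20 : 0 < e / 2 by rewrite divr_gt0.
have [N NP] := len_small e20.
have [k nk kP] := ab n N _ e20.
exists (iter k (induced_map cg) (comb a)); split; first by exists k.
apply: eV; apply: (@le_lt_trans _ _ (e / 2)); last by lra.
rewrite iter_induced_comb; apply: comb_dist_le => // z.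
have l0 := len_gt0 R z.
have [zN|/NP zN] := ltnP (absz z) N.
  by apply: le_lt_trans (kP z zN); rewrite ler_piMr// len_le1.
apply: le_lt_trans zN; rewrite ler_piMl ?(ltW l0)//.
have := a01 (z - k%:Z); have := b01 z; rewrite ler_norml => ? ?.
by apply/andP; split; lra.
Qed.

Lemma omega_limit_spike r v : 2^-1 <= r <= 1 -> 0 <= v < 1 ->
  omega_limit (induced_map cg) (pulse_comb r) (comb (spike r v)).
Proof.
move=> r1 v1; apply: omega_limit_comb => [z|z|n N e e0].
- exact: pulses_itv.
- exact: spike_itv.
have [l Ll vl] := dyadic_dense (n + N).+2 v1 e0.
have ll : (l < 2 ^ l)%N by rewrite ltn_expl.
have hl : (2 ^ l = 2 ^ l.-1 + 2 ^ l.-1)%N.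
  by rewrite -[in LHS](@prednK l) ?expnS; lia.
have l1 : (l.-1 < 2 ^ l.-1)%N by rewrite ltn_expl.
exists (2 ^ l)%N => [|z zN]; first lia.
rewrite /spike; have [->|z0] := eqVneq z 0.
  rewrite sub0r abszN absz_nat -[X in pulses _ X]addn0 pulsesE ?expn_gt0//=.
  by rewrite subrr normr0.
have [->|z1] := eqVneq z (- 1).
  rewrite (_ : absz _ = 2 ^ l + 1)%N; last lia.
  rewrite pulsesE /=; last lia.
  rewrite -mulrBl normrM (@ger0_norm _ 3^-1)//.
  by have := normr_ge0 (v - dyadic l); lra.
(* For z > 0 the entry lies in the preceding block, at offset 2 ^ (l - 1) - z; for z < -1 it lies in
   block [l] at offset |z|. Both offsets are at least 2, where pulses vanish. *)
have [zp|zn] := leP 0 z.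
  rewrite (_ : absz _ = 2 ^ l.-1 + (2 ^ l.-1 - absz z))%N; last lia.
  rewrite pulsesE; last lia.
  by do 2 (rewrite ifN; last lia); rewrite subrr normr0.
rewrite (_ : absz _ = 2 ^ l + absz z)%N; last lia.
rewrite pulsesE; last lia.
by do 2 (rewrite ifN; last lia); rewrite subrr normr0.
Qed.

Lemma omega_limit_comb0 r : 2^-1 <= r <= 1 ->
  omega_limit (induced_map cg) (pulse_comb r) (comb (fun=> 0)).
Proof.
move=> r1; apply: omega_limit_comb => [z|z|n N e e0].
- exact: pulses_itv.
- by rewrite lexx ler01.
pose l := (n + N).+2; have ll : (l < 2 ^ l)%N by rewrite ltn_expl.
(* This is the middle of the block of [l.+1], so far from any pulse that the window shows only
   zeros. *)
exists (2 ^ l.+1 + 2 ^ l)%N => [|z zN]; first by rewrite /l in ll *; lia.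
have e1 : (2 ^ l.+1 = 2 ^ l + 2 ^ l)%N by rewrite expnS; lia.
rewrite (_ : absz _ = 2 ^ l.+1 + absz ((2 ^ l)%:Z - z)%R)%N; last first.
  by rewrite /l in ll *; lia.
rewrite pulsesE; last by rewrite /l in ll e1 *; lia.
by do 2 (rewrite ifN; last by rewrite /l in ll *; lia); rewrite subrr normr0.
Qed.

(** On the arc 0 the spike has height [r] >= 1/2, whereas along the orbit the height there is always
    [r'] or at most 1/3; [eta] is below both differences, 1/6 being 1/2 - 1/3. *)
Lemma spike_notin_omega_limit r r' v :
  2^-1 <= r <= 1 -> 2^-1 <= r' <= 1 -> 0 <= v < 1 -> r <> r' ->
  ~ omega_limit (induced_map cg) (pulse_comb r') (comb (spike r v)).
Proof.
move=> r1 r'1 v1 rr' /(_ 1%N isT).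
pose eta := Num.min `|r - r'| (6^-1).
have eta0 : 0 < eta.
  by rewrite lt_min normr_gt0 subr_eq0 invr_gt0 ltr0n andbT; exact/eqP.
have l0 := lip_gt0 R 0.
move=> /(_ [set A | mdist (comb (spike r v)) A < eta / lip R 0])[].
  by apply/nbhs_metric; exists (eta / lip R 0); first exact: divr_gt0.
move=> _ [[k _ <-]] /=; rewrite iter_induced_comb => lt_eta.
have sr := spike_itv 0 r1 v1.
have pr : 0 <= pulses r' (absz (0 - k%:Z)%R) <= 1 by exact: pulses_itv.
have := @le_comb_dist R (spike r v) (fun z => pulses r' (absz (z - k%:Z)%R)) 0 sr pr.
rewrite ltr_pdivlMr// mulrC in lt_eta => /le_lt_trans/(_ lt_eta).
rewrite {1}/spike eqxx lt_min => /andP[h1 h2].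
have [E|p3] := pulses_value r' (absz (0 - k%:Z)%R).
  by rewrite E ltxx in h1.
by move: h2; rewrite ltr_norml => /andP[_]; lra.
Qed.

Lemma comb_spike_inj r v v' : 2^-1 <= r <= 1 -> 0 <= v < 1 -> 0 <= v' < 1 ->
  comb (spike r v) = comb (spike r v') -> v = v'.
Proof.
move=> r1 v1 v1' /comb_inj E; have := E _ _ (- 1); rewrite /spike /= => E'.
suff : v / 3 = v' / 3 by lra.
by apply: E' => z; exact: spike_itv.
Qed.

Lemma pulse_comb_inj r r' : 2^-1 <= r <= 1 -> 2^-1 <= r' <= 1 ->
  pulse_comb r = pulse_comb r' -> r = r'.
Proof.
move=> r1 r1' /comb_inj E; have := E _ _ 0.
(* Truncated subtraction gives 0 - 2 ^ 0 = 0, so [pulses r 0] is [r]. *)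
by rewrite /pulses trunc_log0; apply => z; exact: pulses_itv.
Qed.

(** The only tooth sits on the arc 0, and any positive shift leaves that arc bare. *)
Lemma spike0_nonperiodic r : 2^-1 <= r <= 1 ->
  ~ periodic_points (induced_map cg) (comb (spike r 0)).
Proof.
move=> r1 [k k0]; rewrite iter_induced_comb => /comb_inj E.
have s01 z : 0 <= spike r 0 z <= 1 by apply: spike_itv => //; rewrite lexx ltr01.
have := E (fun z => s01 _) s01 0; rewrite /spike eqxx.
rewrite ifN; last lia.
by rewrite mul0r; case: ifP => _; lra.
Qed.

Lemma induced_omega_chaotic : omega_chaotic (induced_map cg).
Proof.
have itv_half (x : R) : x \in `[2^-1, 1[ -> 2^-1 <= x <= 1.
  by rewrite in_itv/= => /andP[-> /ltW].
exists (pulse_comb @` `[2^-1, 1[); split.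
  apply: uncountable_image; first by rewrite invf_lt1// ltr1n.
  by move=> x y /itv_half ? /itv_half ?; exact: pulse_comb_inj.
split.
  exists (pulse_comb 2^-1), (pulse_comb (2 / 3)); split.
  - by exists 2^-1 => //=; rewrite in_itv/= lexx/=; lra.
  - by exists (2 / 3) => //=; rewrite in_itv/=; apply/andP; split; lra.
  - move=> /pulse_comb_inj E; have : (2^-1 : R) = 2 / 3 by apply: E; lra.
    lra.
move=> _ _ [r /= /itv_half r1 <-] [r' /= /itv_half r1' <-] rr'.
have {}rr' : r <> r' by move=> E; apply: rr'; rewrite E.
split.
(* The spikes with first tooth [r] form an uncountable family inside one limit set and outside the
   other. *)
- have : ~ countable ((fun v => comb (spike r v)) @` `[0, 1[).
    apply: uncountable_image => // x y; rewrite !in_itv/= => x1 y1.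
    exact: comb_spike_inj.
  apply: contra_not; apply: sub_countable; apply: subset_card_le.
  move=> _ [v /= + <-]; rewrite in_itv/= => v1; split.
    exact: omega_limit_spike.
  exact: spike_notin_omega_limit.
- by exists (comb (fun=> 0)); split; exact: omega_limit_comb0.
- exists (comb (spike r 0)); split; last exact: spike0_nonperiodic.
  by apply: omega_limit_spike => //; rewrite lexx ltr01.
Qed.

End omega_chaos.

Theorem mainTheorem7 (R : realType) :
  dendrite (star R) /\
  (exists! g : star R -> star R, star_shift g) /\
  forall g : star R -> star R, star_shift g ->
    [/\ homeomorphism g,
        fixed_points g = [set star0 R],
        forall n : int, g @` star_arc R n = star_arc R (n + 1),
        forall x : star R, asymptotic g x (star0 R) &
        entropy g = 0%E] /\
    exists cg : continuous g,
      omega_chaotic (induced_map cg) /\ entropy (induced_map cg) = +oo%E.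
Proof.
split; first exact: star_dendrite.
split.
  exists (shift_by 1); split; first exact/star_shiftE.
  by move=> g /star_shiftE ->.
move=> _ /star_shiftE ->; split.
  split.
  - exact: shift_by_homeomorphism.
  - exact: fixed_points_shift_by1.
  - by move=> n; exact: shift_by_arc.
  - exact: shift_by1_asymptotic.
  - exact: shift_by1_entropy.
exists (@shift_by_continuous R 1); split; first exact: induced_omega_chaotic.
exact: induced_entropy.
Qed.
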